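(* Let $d\ge 2$ be a fixed integer and let $\delta\in[0,1)$, $\alpha\in[0,1]$, $\beta\in\mathbb R$ be constants. Let $s=s_n=n^{-(d-1)+\delta+o(1)}$, $p=p_n=n^{-1+\alpha+o(1)}\le 1$, $q=q_n=n^{-1+\beta+o(1)}\le p$, and let $\mathbb P=\mathbb P_n$ (noisy projection model) and $\mathbb Q=\mathbb Q_n$ (Erdős–Rényi model with edge density $q$) be as defined in the context. If $\beta>2(\delta+\alpha)-1$, then the total variation distance satisfies $\operatorname{TV}(\mathbb P,\mathbb Q)=o(1)$ as $n\to\infty$. Consequently no test statistic achieves weak detection between $\mathbb P$ and $\mathbb Q$.
   Context: Model. $\operatorname U_{n,d}$ is the collection of all $d$-element subsets of $[n]=\{1,\dots,n\}$. The random $d$-uniform hypergraph $\mathcal H\sim\mu$ on $[n]$ includes each $\Psi\in \operatorname U_{n,d}$ independently with probability $s\in[0,1]$. The projection $\mathcal P(\mathcal H)$ is the graph on $[n]$ in which an unordered pair $(i,j)$, $i\ne j$, is an edge if and only if some $\Psi\in\mathcal H$ contains both $i$ and $j$. Under $\mathbb P$: first sample $\mathcal H\sim\mu$; then, conditionally on $\mathcal H$, the random graph $A$ on $[n]$ includes, independently over pairs, each pair $(i,j)\in\mathcal P(\mathcal H)$ with probability $p$ and each pair $(i,j)\notin\mathcal P(\mathcal H)$ with probability $q$; $\mathbb P$ also denotes the resulting (marginal) law of $A$. Under $\mathbb Q$, $A$ is an Erdős–Rényi graph on $[n]$ with each edge present independently with probability $q$. Weak detection: a test $\phi=\phi(A)\in\{0,1\}$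 achieves weak detection between $\mathbb P$ and $\mathbb Q$ if $\mathbb P(\phi(A)=0)+\mathbb Q(\phi(A)=1)=1-\Omega(1)$ as $n\to\infty$, i.e. there is a constant $c>0$ such that the sum is at most $1-c$ for all sufficiently large $n$. All asymptotics are as $n\to\infty$ with $d,\alpha,\beta,\delta$ fixed. *)

(* Defs.v *)
From mathcomp Require Import all_boot all_order all_algebra.
From mathcomp Require Import all_classical all_reals all_analysis.
Set Implicit Arguments.
Unset Strict Implicit.
Unset Printing Implicit Defensive.
Import Order.TTheory GRing.Theory Num.Theory.
Import numFieldNormedType.Exports.
Local Open Scope classical_set_scope.
Local Open Scope ring_scope.

(* U_{n,k}, with the ground set [n] rendered as 'I_n. *)
Definition ksubset (n k : nat) : Type := {Psi : {set 'I_n} | #|Psi| == k}.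

Definition hypergraph (n d : nat) : Type := {set (ksubset n d)}.

(* Edge sets of simple graphs: an edge is an unordered pair {i, j}, i != j. *)
Definition graph (n : nat) : Type := {set (ksubset n 2)}.

Definition projection (n d : nat) (H : hypergraph n d) : graph n :=
  [set e : ksubset n 2 |
    [exists Psi : ksubset n d, (Psi \in H) && (val e \subset val Psi)]]%SET.

(* Probability mass function of the random subset of T that contains each
   x independently with probability w x. *)
Definition bernoulli_set (R : realType) (T : finType) (w : T -> R)
    (X : {set T}) : R :=
  \prod_(x : T) (if x \in X then w x else 1 - w x).

Definition hypergraph_law (R : realType) (n d : nat) (s : R) :
    hypergraph n d -> R :=
  bernoulli_set (fun=> s).

Definition noisy_law (R : realType) (n d : nat) (p q : R)
    (H : hypergraph n d) : graph n -> R :=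
  bernoulli_set (fun e => if e \in projection H then p else q).

Definition planted_law (R : realType) (n d : nat) (s p q : R) (A : graph n) :
    R :=
  \sum_(H : hypergraph n d) hypergraph_law s H * noisy_law p q H A.

Definition null_law (R : realType) (n : nat) (q : R) : graph n -> R :=
  bernoulli_set (fun=> q).

Arguments planted_law {R} n d s p q A.
Arguments null_law {R} n q _.

Definition Prob (R : realType) (T : finType) (f : T -> R) (B : {pred T}) : R :=
  \sum_(x in B) f x.

Definition TV (R : realType) (T : finType) (f g : T -> R) : R :=
  \big[Num.max/0]_(B : {set T}) `|Prob f (mem B) - Prob g (mem B)|.

(* u_n = n^{x + o(1)}.  The equation is only imposed for large n because the
   right-hand side is degenerate at n = 0 and n = 1. *)
Definition eq_npow (R : realType) (u : nat -> R) (x : R) : Prop :=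
  exists2 eps : nat -> R, eps n @[n --> \oo] --> (0 : R) &
    \forall n \near \oo, u n = n%:R `^ (x + eps n).

(* [phi n A = true] stands for phi(A) = 1. *)
Definition weak_detection (R : realType) (P Q : forall n, graph n -> R)
    (phi : forall n, graph n -> bool) : Prop :=
  exists2 c : R, 0 < c &
    \forall n \near \oo,
      Prob (P n) [pred A | phi n A == false] +
      Prob (Q n) [pred A | phi n A == true] <= 1 - c.

Lemma bernoulli_set_ge0 (R : realType) (T : finType) (w : T -> R) :
  (forall x, 0 <= w x <= 1) -> forall X, 0 <= bernoulli_set w X.
Proof.
move=> w01 X; apply: prodr_ge0 => x _.
by have /andP[w0 w1] := w01 x; case: ifP => _ //; rewrite subr_ge0.
Qed.

Lemma bernoulli_set_sum1 (R : realType) (T : finType) (w : T -> R) :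
  \sum_(X : {set T}) bernoulli_set w X = 1.
Proof.
rewrite -(bigA_distr _ _ w (fun x => 1 - w x)).
by rewrite big1 //= => x _; rewrite subrKC.
Qed.

Lemma planted_law_ge0 (R : realType) (n d : nat) (s p q : R) :
  0 <= s <= 1 -> 0 <= p <= 1 -> 0 <= q <= 1 ->
  forall A : graph n, 0 <= planted_law n d s p q A.
Proof.
move=> s01 p01 q01 A; apply: sumr_ge0 => H _.
by apply: mulr_ge0; apply: bernoulli_set_ge0 => // e; case: ifP.
Qed.

Lemma planted_law_sum1 (R : realType) (n d : nat) (s p q : R) :
  \sum_(A : graph n) planted_law n d s p q A = 1.
Proof.
rewrite exchange_big /= -[RHS](bernoulli_set_sum1 (fun _ : ksubset n d => s)).
by apply: eq_bigr => H _; rewrite -mulr_sumr bernoulli_set_sum1 mulr1.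
Qed.

(* Main.v *)
(* Second moment method. Averaging over two independent hypergraphs H and H',
   1 + chi^2(P || Q) = E (1 + l)^|P(H) :&: P(H')| with
   l = (p - q)^2 / (q (1 - q)) <= 2 p^2 / q. Bounding |P(H) :&: G| by the sum
   over Psi in H of the number of edges of G inside Psi makes the exponent
   linear in H once G = P(H') is fixed, and |P(H')| <= 'C(d, 2) |H'| then makes
   it linear in H'. Two Bernoulli moment generating functions give
   1 + chi^2 <= exp (C l (s n^(d-1))^2), whose exponent is
   n^(2 delta + 2 alpha - 1 - beta + o(1)), hence o(1). *)

Require Import Defs.
From mathcomp Require Import all_boot all_order all_algebra.
From mathcomp Require Import all_classical all_reals all_analysis.
From mathcomp Require Import ring lra.
Set Implicit Arguments.
Unset Strict Implicit.
Unset Printing Implicit Defensive.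
Import Order.TTheory GRing.Theory Num.Theory.
Import numFieldNormedType.Exports.
Local Open Scope classical_set_scope.
Local Open Scope ring_scope.

(** * Random subsets, total variation and the chi-square bound *)

Section BernoulliSet.
Context {R : realType} {T : finType}.
Implicit Types (w a : T -> R).

(** Choosing one summand of [w x * a x + (1 - w x)] for each [x] selects a subset. For exponential
    [a] this evaluates the moment generating function of a linear statistic of the random set. *)
Lemma sum_bernoulli_set_prod w a :
  \sum_(X : {set T}) bernoulli_set w X * \prod_(x in X) a x =
  \prod_x (1 + w x * (a x - 1)).
Proof.
transitivity (\prod_x (w x * a x + (1 - w x))); last first.
  by apply: eq_bigr => x _; ring.
rewrite (bigA_distr _ _ (fun x => w x * a x) (fun x => 1 - w x)).
apply: eq_bigr => X _; rewrite big_mkcond -big_split /=.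
by apply: eq_bigr => x _; case: ifP => _ //; rewrite mulr1.
Qed.

(** Mixed second moment of two likelihood ratios: by independence it factors over the
    coordinates. *)
Lemma sum_bernoulli_setMM w1 w2 (q : R) :
  \sum_(X : {set T})
    bernoulli_set w1 X * bernoulli_set w2 X / bernoulli_set (fun=> q) X =
  \prod_x (w1 x * w2 x / q + (1 - w1 x) * (1 - w2 x) / (1 - q)).
Proof.
rewrite (bigA_distr _ _ (fun x => w1 x * w2 x / q)
  (fun x => (1 - w1 x) * (1 - w2 x) / (1 - q))).
apply: eq_bigr => X _; rewrite -prodfV -!big_split /=.
by apply: eq_bigr => x _; case: ifP.
Qed.

Lemma bernoulli_set_gt0 w (X : {set T}) :
  (forall x, 0 < w x < 1) -> 0 < bernoulli_set w X.
Proof.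
move=> w01; apply: prodr_gt0 => x _.
by have /andP[w0 w1] := w01 x; case: ifP => _ //; rewrite subr_gt0.
Qed.

(** The sharp factor 1/2 is dropped, since only convergence to 0 matters. *)
Lemma TV_le_sum (f g : T -> R) : TV f g <= \sum_x `|f x - g x|.
Proof.
apply: bigmax_le => [|B _]; first exact: sumr_ge0.
rewrite /Prob -sumrB; apply: le_trans (ler_norm_sum _ _ _) _.
by rewrite [leRHS](bigID [in B]) /= lerDl sumr_ge0.
Qed.

Lemma ler_TV (f g : T -> R) (B : {pred T}) : Prob f B - Prob g B <= TV f g.
Proof.
apply: le_trans (ler_norm _) _.
have := @le_bigmax _ _ _ 0
  (fun B : {set T} => `|Prob f (mem B) - Prob g (mem B)|) [set x in B]%SET.
apply: le_trans; rewrite /Prob.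
by under [in leRHS]eq_bigl do rewrite inE;
   under [X in _ <= `|_ - X|]eq_bigl do rewrite inE.
Qed.

(* AM-GM in the form [|f - g| <= e g + (f - g)^2 / (e g)], summed. *)
Lemma TV_le_chi2 (f g : T -> R) (e : R) : 0 < e -> (forall x, 0 < g x) ->
  \sum_x f x = 1 -> \sum_x g x = 1 ->
  TV f g <= e + (\sum_x f x * f x / g x - 1) / e.
Proof.
move=> e0 g0 sf sg; apply: le_trans (TV_le_sum f g) _.
(* As both masses are 1, the chi-square term is the sum of f^2/g - 2f + g = (f - g)^2/g, so the
   bound can be checked pointwise. *)
have -> : e + (\sum_x f x * f x / g x - 1) / e =
    \sum_x (e * g x + (f x * f x / g x - f x - f x + g x) / e).
  rewrite big_split /= -mulr_sumr sg mulr1 -mulr_suml big_split /= !sumrB.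
  by rewrite sf sg subrK.
apply: ler_sum => x _.
have gx0 := g0 x.
have -> : f x * f x / g x - f x - f x + g x = `|f x - g x| ^+ 2 / g x.
  by rewrite real_normK ?num_real//; field; rewrite gt_eqF.
set y := `|_|.
have y0 : 0 <= y by exact: normr_ge0.
have eg0 : 0 < e * g x by rewrite mulr_gt0.
have -> : e * g x + y ^+ 2 / g x / e = ((e * g x) ^+ 2 + y ^+ 2) / (e * g x).
  by field; rewrite !gt_eqF.
by rewrite ler_pdivlMr//; nra.
Qed.

End BernoulliSet.

(** * Counting incidences between edges and hyperedges *)

Lemma leq_bin_exp (n k : nat) : ('C(n, k) <= n ^ k)%N.
Proof.
have h : (n ^_ k <= n ^ k)%N.
  by elim: k => // k IH; rewrite ffactnSr expnSr leq_mul ?leq_subr.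
by apply: leq_trans h; rewrite -bin_ffact leq_pmulr ?fact_gt0.
Qed.

Section Subsets.
Context {n d : nat}.
Implicit Types (H : hypergraph n d) (G : graph n).

Lemma card_ksubset_le : (#|{: ksubset n d}| <= n ^ d)%N.
Proof.
by rewrite card_sig -cardsE card_draws card_ord leq_bin_exp.
Qed.

Lemma card_edges_in (Psi : ksubset n d) :
  (#|[set e : ksubset n 2 | val e \subset val Psi]%SET| <= 'C(d, 2))%N.
Proof.
rewrite -(card_imset _ val_inj) -[in 'C(d, 2)](eqP (valP Psi)) -cards_draws.
apply/subset_leq_card/fintype.subsetP => _ /imsetP[e + ->].
by rewrite !inE (valP e) andbT.
Qed.

(** [Psi] is recovered from [Psi] minus [e], which has d - 2 elements. *)
Lemma card_ksubsets_over (e : ksubset n 2) :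
  (#|[set Psi : ksubset n d | val e \subset val Psi]%SET| <= n ^ (d - 2))%N.
Proof.
pose f (Psi : ksubset n d) : {set 'I_n} := (val Psi :\: val e)%SET.
rewrite -(card_in_imset (f := f)); last first.
  move=> P Q; rewrite !inE => eP eQ PQ; apply: val_inj.
  by rewrite -[LHS](finset.setID _ (val e)) -[RHS](finset.setID _ (val e))
    -!/(f _) PQ (finset.setIidPr eP) (finset.setIidPr eQ).
apply: leq_trans (leq_bin_exp n (d - 2)).
rewrite -[in 'C(n, _)](card_ord n) -card_draws.
apply/subset_leq_card/fintype.subsetP => _ /imsetP[P + ->].
by rewrite !inE => eP; rewrite cardsDS// (eqP (valP P)) (eqP (valP e)).
Qed.

(** Union bound: every edge of the projection lies in at least one hyperedge of [H]. *)
Lemma card_projectionI H G :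
  (#|(projection H :&: G)%SET| <=
   \sum_(Psi in H) #|[set e in G | val e \subset val Psi]%SET|)%N.
Proof.
rewrite -sum1_card.
under [leqRHS]eq_bigr => Psi _.
  rewrite -sum1_card big_mkcond; over.
rewrite exchange_big /= big_mkcond; apply: leq_sum => e _.
rewrite !inE; case: ifP => // /andP[/existsP[Psi /andP[PH ePsi]] eG].
by rewrite (bigD1 Psi) //= !inE eG ePsi leq_addr.
Qed.

Lemma card_projection H : (#|projection H| <= #|H| * 'C(d, 2))%N.
Proof.
have := card_projectionI H [set: ksubset n 2]%SET.
rewrite finset.setIT => /leq_trans; apply; rewrite -sum_nat_const.
apply: leq_sum => Psi _; apply: leq_trans (card_edges_in Psi).
by apply/subset_leq_card/fintype.subsetP => e; rewrite !inE.
Qed.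

(** Double counting of the pairs of an edge of [G] and a hyperedge over it. *)
Lemma sum_card_edges_in G :
  (\sum_(Psi : ksubset n d) #|[set e in G | val e \subset val Psi]%SET| <=
   #|G| * n ^ (d - 2))%N.
Proof.
rewrite -sum_nat_const.
under [leqLHS]eq_bigr => Psi _.
  rewrite -sum1_card big_mkcond; over.
rewrite exchange_big /= [leqRHS]big_mkcond; apply: leq_sum => e _.
case: ifP => eG; last by rewrite big1 // => Psi _; rewrite !inE eG.
apply: leq_trans (card_ksubsets_over e).
by rewrite -sum1_card [leqRHS]big_mkcond leq_sum // => Psi _; rewrite !inE eG.
Qed.

End Subsets.

(** * Moment generating functions of the overlap *)

Lemma exprD1_le (R : realType) (l : R) (m k : nat) : 0 <= l <= 1 ->
  (m <= k)%N -> (1 + l) ^+ m <= 1 + l * 2 ^+ k * m%:R.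
Proof.
move=> /andP[l0 l1] mk.
(* Passing from [j] to [j.+1] adds l (1 + l)^j <= l 2^j <= l 2^k, so the slope is uniform when [k]
   stays fixed. *)
have h j : (j <= m)%N -> (1 + l) ^+ j <= 1 + l * 2 ^+ k * j%:R.
  elim: j => [|j IH] jm; first by rewrite expr0 mulr0 addr0.
  rewrite exprS mulrDl mul1r -[j.+1%:R]natr1 mulrDr mulr1 addrA.
  rewrite lerD ?IH 1?ltnW//.
  apply: ler_wpM2l => //; apply: (@le_trans _ _ (2 ^+ j)).
    by apply: lerXn2r; rewrite ?nnegrE; lra.
  by rewrite ler_weXn2l ?ler1n// (leq_trans (ltnW jm)).
exact: h.
Qed.

Section MomentBounds.
Context {R : realType} {n d : nat}.
Implicit Types (s l t : R).

(** The union bound makes the exponent additive over hyperedges, so the mean factors. Each [X Psi]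
    is at most 'C(d, 2), hence each factor is linear in [X Psi] up to a constant, and 1 + x <= exp x
    recombines them. *)
Lemma mgf_card_projectionI s l (G : graph n) : 0 <= s <= 1 -> 0 <= l <= 1 ->
  \sum_(H : hypergraph n d)
     hypergraph_law s H * (1 + l) ^+ #|(projection H :&: G)%SET| <=
  expR (s * l * 2 ^+ 'C(d, 2) * (#|G| * n ^ (d - 2))%:R).
Proof.
move=> /andP[s0 s1] l01; have /andP[l0 l1] := l01.
pose X (Psi : ksubset n d) := #|[set e in G | val e \subset val Psi]%SET|.
have XD Psi : (X Psi <= 'C(d, 2))%N.
  apply: leq_trans (card_edges_in Psi).
  by apply/subset_leq_card/fintype.subsetP => e; rewrite !inE => /andP[].
apply: (@le_trans _ _ (\sum_(H : hypergraph n d)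
    hypergraph_law s H * \prod_(Psi in H) (1 + l) ^+ X Psi)).
  apply: ler_sum => H _; apply: ler_wpM2l.
    by apply: bernoulli_set_ge0 => ?; rewrite s0.
  by rewrite -expr_sum ler_weXn2l ?card_projectionI// lerDl.
rewrite sum_bernoulli_set_prod.
apply: (@le_trans _ _ (\prod_Psi expR (s * l * 2 ^+ 'C(d, 2) * (X Psi)%:R))).
  apply: ler_prod => Psi _; apply/andP; split.
    rewrite addr_ge0// mulr_ge0// subr_ge0 exprn_ege1 // lerDl //.
  apply: le_trans (expR_ge1Dx _); rewrite lerD2l -!mulrA ler_wpM2l//.
  by rewrite lerBlDl mulrA exprD1_le.
rewrite -expR_sum ler_expR -mulr_sumr -natr_sum.
rewrite ler_wpM2l ?ler_nat ?sum_card_edges_in//.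
by rewrite !mulr_ge0 ?exprn_ge0.
Qed.

Lemma mgf_card_hypergraph s t : 0 <= s -> 0 <= t <= 2^-1 ->
  \sum_(H : hypergraph n d) hypergraph_law s H * expR (t * #|H|%:R) <=
  expR (2 * s * t * (n ^ d)%:R).
Proof.
move=> s0 /andP[t0 t2].
under eq_bigr do rewrite mulr_natr -mulr_natl expRM_natl -prodr_const.
rewrite sum_bernoulli_set_prod.
apply: (@le_trans _ _ (\prod_(Psi : ksubset n d) expR (2 * s * t))).
  apply: ler_prod => Psi _; apply/andP; split.
    by rewrite addr_ge0// mulr_ge0// subr_ge0 -expR0 ler_expR.
  apply: le_trans (expR_ge1Dx _).
  rewrite lerD2l (mulrC 2) -mulrA ler_wpM2l//.
  (* Together with [e2] this gives exp t <= 1/(1 - t), which is at most 1 + 2t exactly because 0 <=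
     t <= 1/2. *)
  have e1 : 1 - t <= expR (- t) := expR_ge1Dx (- t).
  have e2 : expR t * expR (- t) = 1 by rewrite -expRD subrr expR0.
  have := expR_gt0 t; nra.
rewrite -expR_sum ler_expR sumr_const -[leLHS]mulr_natr.
rewrite ler_wpM2l//.
  by rewrite !mulr_ge0.
by rewrite ler_nat card_ksubset_le.
Qed.

(** Conditioning on [H'] reduces to a fixed graph. Since each hyperedge of [H'] projects to at most
    'C(d, 2) edges, the resulting exponent is at most [t] per hyperedge of [H']. *)
Lemma mgf_card_projectionI2 s l :
  let t := s * l * 2 ^+ 'C(d, 2) * 'C(d, 2)%:R * (n ^ (d - 2))%:R in
  0 <= s <= 1 -> 0 <= l <= 1 -> t <= 2^-1 ->
  \sum_(H' : hypergraph n d) \sum_(H : hypergraph n d)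
     hypergraph_law s H' * hypergraph_law s H *
       (1 + l) ^+ #|(projection H :&: projection H')%SET| <=
  expR (2 * s * t * (n ^ d)%:R).
Proof.
move=> t s01 l01 t2; have /andP[s0 s1] := s01; have /andP[l0 l1] := l01.
have t0 : 0 <= t by rewrite !mulr_ge0 ?exprn_ge0.
apply: le_trans (mgf_card_hypergraph s0 _); last by rewrite t0.
apply: ler_sum => H' _; under eq_bigr do rewrite -mulrA.
rewrite -mulr_sumr; apply: ler_wpM2l.
  by apply: bernoulli_set_ge0 => ?.
apply: le_trans (mgf_card_projectionI _ s01 l01) _.
rewrite ler_expR /t -!mulrA !ler_wpM2l//.
rewrite -!natrM ler_nat mulnC mulnA -mulnA mulnCA leq_mul2l (mulnC _ #|_|).
by rewrite card_projection orbT.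
Qed.

End MomentBounds.

(** * The likelihood ratio of the planted model *)

Section Model.
Context {R : realType} {n d : nat}.
Implicit Types (s p q l : R).

(** An edge missing from one of the two projections has density [q] there and contributes the factor
    1; a common edge contributes p^2/q + (1 - p)^2/(1 - q). *)
Lemma sum_noisy_lawMM p q (H H' : hypergraph n d) : 0 < q < 1 ->
  \sum_(A : graph n) noisy_law p q H A * noisy_law p q H' A / null_law n q A =
  (1 + (p - q) ^+ 2 / (q * (1 - q))) ^+
    #|(projection H :&: projection H')%SET|.
Proof.
move=> /andP[q0 q1]; have q10 : 0 < 1 - q by rewrite subr_gt0.
rewrite sum_bernoulli_setMM -prodr_const big_mkcond [RHS]big_mkcond /=.
apply: eq_bigr => e _; rewrite !inE.
by do 2!case: ifP => _ /=; field; rewrite !gt_eqF.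
Qed.

Lemma sum_planted_law_sqr s p q : 0 < q < 1 ->
  \sum_(A : graph n)
     planted_law n d s p q A * planted_law n d s p q A / null_law n q A =
  \sum_(H' : hypergraph n d) \sum_(H : hypergraph n d)
     hypergraph_law s H' * hypergraph_law s H *
       (1 + (p - q) ^+ 2 / (q * (1 - q))) ^+
         #|(projection H :&: projection H')%SET|.
Proof.
move=> q01.
under [RHS]eq_bigr => H' _.
  under eq_bigr => H _ do rewrite -(sum_noisy_lawMM p H H' q01) mulr_sumr.
  rewrite exchange_big; over.
rewrite [RHS]exchange_big /=; apply: eq_bigr => A _.
rewrite /planted_law big_distrlr /= mulr_suml.
apply: eq_bigr => H' _; rewrite mulr_suml; apply: eq_bigr => H _.
by ring.
Qed.

(** Covers the degenerate density 1, where the chi-square argument breaks down. *)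
Lemma planted_law1 s : planted_law n d s 1 1 = null_law n (1 : R).
Proof.
apply/funext => A; rewrite /planted_law.
rewrite -[RHS]mul1r -(bernoulli_set_sum1 (fun _ : ksubset n d => s)) mulr_suml.
apply: eq_bigr => H _; congr (_ * _).
by apply: eq_bigr => e _; rewrite if_same.
Qed.

Lemma signal_to_noise_le p q : 0 < q < 1 -> q <= p <= 1 ->
  (p - q) ^+ 2 / (q * (1 - q)) <= 2 * (p ^+ 2 / q).
Proof.
move=> /andP[q0 q1] /andP[qp p1]; have q10 : 0 < 1 - q by rewrite subr_gt0.
have -> : (p - q) ^+ 2 / (q * (1 - q)) = (p - q) ^+ 2 / (1 - q) / q.
  by field; rewrite !gt_eqF.
rewrite [leRHS]mulrA ler_pM2r ?invr_gt0// ler_pdivrMr//.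
have pq0 : 0 <= p - q by rewrite subr_ge0.
(* For q <= 1/2 the factor 1 - q is at least 1/2. Otherwise p - q <= 1 - q cancels the small
   denominator, and p >= 1/2 absorbs the rest. *)
have [q2|q2] := leP q 2^-1.
  have : (p - q) ^+ 2 <= p ^+ 2 by nra.
  have := sqr_ge0 p; nra.
have h1 : (p - q) ^+ 2 <= (1 - q) ^+ 2 by nra.
have h2 : 4^-1 <= p ^+ 2 by nra.
by nra.
Qed.

Lemma TV_planted_null s p q (e : R) :
  let L := 2 * (p ^+ 2 / q) in
  let D := 'C(d, 2) in
  let t := s * L * 2 ^+ D * D%:R * (n ^ (d - 2))%:R in
  0 < e -> 0 <= s <= 1 -> 0 < q -> q <= p <= 1 -> L <= 1 -> t <= 2^-1 ->
  TV (planted_law n d s p q) (null_law n q) <=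
    e + (expR (2 * s * t * (n ^ d)%:R) - 1) / e.
Proof.
move=> L D t e0 s01 q0 qp1 L1 t2; have /andP[s0 _] := s01.
have /andP[qp p1] := qp1.
have L0 : 0 <= L by rewrite mulr_ge0// divr_ge0 ?sqr_ge0 ?ltW.
have t0 : 0 <= t.
  by rewrite mulr_ge0// mulr_ge0// mulr_ge0 ?exprn_ge0// mulr_ge0.
(* If q = 1 then p = 1 and both laws coincide; otherwise the null law is positive everywhere and
   chi-square applies. *)
have [q1|q1] := ltP q 1; last first.
  have -> : q = 1 by lra.
  have -> : p = 1 by lra.
  rewrite planted_law1; apply: le_trans (TV_le_sum _ _) _.
  rewrite big1 => [|A _]; last by rewrite subrr normr0.
  have E0 : 0 <= 2 * s * t * (n ^ d)%:R.
    by rewrite mulr_ge0// mulr_ge0// mulr_ge0.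
  apply: addr_ge0; first exact: ltW.
  apply: divr_ge0; last exact: ltW.
  by rewrite subr_ge0; apply: le_trans (expR_ge1Dx _); rewrite lerDl.
have q01 : 0 < q < 1 by rewrite q0.
have A1 := planted_law_sum1 n d s p q.
have g0 (A : graph n) : 0 < null_law n q A.
  by apply: bernoulli_set_gt0.
apply: le_trans (TV_le_chi2 e0 g0 A1 (bernoulli_set_sum1 _)) _.
rewrite lerD2l ler_pM2r ?invr_gt0// lerD2r sum_planted_law_sqr//.
set l := (p - q) ^+ 2 / _.
have l0 : 0 <= l by rewrite divr_ge0 ?sqr_ge0// mulr_ge0 ?subr_ge0 ?ltW.
have lL : l <= L by exact: signal_to_noise_le.
apply: le_trans (mgf_card_projectionI2 s01 _ t2).
  apply: ler_sum => H' _; apply: ler_sum => H _.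
  apply: ler_wpM2l; first by rewrite mulr_ge0// bernoulli_set_ge0.
  by apply: lerXn2r; rewrite ?nnegrE ?addr_ge0// lerD2l.
by rewrite L0.
Qed.

(** The error sum is 1 - (P(phi = 1) - Q(phi = 1)). *)
Lemma testing_error_ge s p q (phi : graph n -> bool) :
  1 - TV (planted_law n d s p q) (null_law n q) <=
  Prob (planted_law n d s p q) [pred A | phi A == false] +
  Prob (null_law n q) [pred A | phi A == true].
Proof.
have := ler_TV (planted_law n d s p q) (null_law n q) [pred A | phi A == true].
have := planted_law_sum1 n d s p q.
rewrite (bigID [pred A | phi A == true]) /= /Prob.
have -> : \sum_(A in [pred A | phi A == false]) planted_law n d s p q A =
    \sum_(A : graph n | phi A != true) planted_law n d s p q A.
  by apply: eq_bigl => A; rewrite !inE; case: phi.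
lra.
Qed.

End Model.

(** * Calculus of the growth rates n^(x + o(1)) *)

Section PolynomialGrowth.
Context {R : realType}.
Implicit Types (u v : nat -> R) (x y : R).

Lemma eq_npowM u v x y :
  eq_npow u x -> eq_npow v y -> eq_npow (fun n => u n * v n) (x + y).
Proof.
move=> [a a0 ua] [b b0 vb]; exists (fun n => a n + b n).
  by rewrite -[0 in X in _ --> X]addr0; exact: cvgD.
near=> n; have n0 : (0 < n)%N by near: n; exists 1%N.
rewrite (near ua n)// (near vb n)// -powRD 1?addrACA//.
by rewrite pnatr_eq0 -lt0n n0 implybT.
Unshelve. all: by end_near. Qed.

Lemma eq_npowV u x : eq_npow u x -> eq_npow (fun n => (u n)^-1) (- x).
Proof.
move=> [a a0 ua]; exists (fun n => - a n).
  by rewrite -[0 in X in _ --> X]oppr0; exact: cvgN.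
by apply: filterS ua => n ->; rewrite -opprD powRN.
Qed.

Lemma eq_npow_natX (k : nat) : eq_npow (fun n => (n ^ k)%:R) (k%:R : R).
Proof.
exists (fun=> 0); first exact: cvg_cst.
by apply: nearW => n; rewrite addr0 powR_mulrn// natrX.
Qed.

Lemma eq_npow_gt0 u x : eq_npow u x -> \forall n \near \oo, 0 < u n.
Proof.
move=> [a _ ua]; near=> n; rewrite (near ua n)//.
by rewrite powR_gt0// ltr0n; near: n; exists 1%N.
Unshelve. all: by end_near. Qed.

(** Eventually the o(1) term is below -x/2, which leaves a bound by n^(x/2). *)
Lemma eq_npow_cvg0 u x : x < 0 -> eq_npow u x -> u n @[n --> \oo] --> (0 : R).
Proof.
move=> x0 [a a0 ua].
have y0 : 0 < - x / 2 by lra.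
have ax : \forall n \near \oo, a n < - x / 2 by exact: cvgr_lt a0 _ y0.
apply/cvgrPdist_lt => e e0.
(* Chosen so that B^(-x/2) = 1/e + 1; the added 1 gives a strict inequality. *)
pose B := (e^-1 + 1) `^ (- x / 2)^-1.
have [N _ NB] := nbhs_infty_gtr B.
near=> n.
have n1 : 1 <= n%:R :> R by rewrite ler1n; near: n; exists 1%N.
have Bn : B < n%:R by apply: NB; near: n; exists N.
rewrite sub0r normrN (near ua n)// ger0_norm ?powR_ge0//.
apply: (@le_lt_trans _ _ (n%:R `^ (- (- x / 2)))).
  have axn : a n < - x / 2 by near: n.
  by apply: ler_powR => //; lra.
rewrite powRN invf_plt ?posrE ?powR_gt0//; last by rewrite (lt_le_trans _ n1).
apply: (@lt_le_trans _ _ (e^-1 + 1)); first by rewrite ltrDl.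
have e1 : 0 <= e^-1 + 1 by rewrite addr_ge0// invr_ge0 ltW.
have -> : e^-1 + 1 = B `^ (- x / 2).
  by rewrite -powRrM mulVf ?gt_eqF// powRr1.
by apply: ge0_ler_powR; rewrite ?nnegrE ?powR_ge0// ltW.
Unshelve. all: by end_near. Qed.

End PolynomialGrowth.

(** * Asymptotics and impossibility of weak detection *)

Theorem proposition2p5 (R : realType) (d : nat) (delta alpha beta : R)
    (s p q : nat -> R)
    (hd : (2 <= d)%N)
    (hdelta : 0 <= delta < 1)
    (halpha : 0 <= alpha <= 1)
    (hs01 : forall n, 0 <= s n <= 1)
    (hp1 : forall n, p n <= 1)
    (hqp : forall n, 0 <= q n <= p n)
    (hs : eq_npow s (- (d%:R - 1) + delta))
    (hp : eq_npow p (-1 + alpha))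
    (hq : eq_npow q (-1 + beta))
    (hbeta : 2 * (delta + alpha) - 1 < beta) :
  TV (planted_law n d (s n) (p n) (q n)) (null_law n (q n))
    @[n --> \oo] --> (0 : R) /\
  (forall phi : forall n, graph n -> bool,
     ~ weak_detection (fun n => planted_law n d (s n) (p n) (q n))
                      (fun n => null_law n (q n)) phi).
Proof.
have /andP[de0 de1] := hdelta.
pose L n := 2 * (p n ^+ 2 / q n).
pose D := 'C(d, 2).
pose t n := s n * L n * 2 ^+ D * D%:R * (n ^ (d - 2))%:R.
pose v n := 2 * s n * t n * (n ^ d)%:R.
have hr : eq_npow (fun n => p n * p n / q n)
    (- 1 + alpha + (- 1 + alpha) + - (- 1 + beta)).
  exact: eq_npowM (eq_npowM hp hp) (eq_npowV hq).
have hsd := eq_npowM hs (eq_npow_natX (d - 2)).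
have d2 : (d - 2)%:R = d%:R - 2 :> R by rewrite natrB.
(* The exponent 2 alpha - 1 - beta is negative by [hbeta] and delta >= 0. *)
have L0 : L n @[n --> \oo] --> (0 : R).
  rewrite -[0 in X in _ --> X](mulr0 (2 : R)); apply: cvgMr.
  by apply: eq_npow_cvg0 hr; lra.
have t0 : t n @[n --> \oo] --> (0 : R).
  have -> : t = fun n => L n * (s n * (n ^ (d - 2))%:R) * (2 ^+ D * D%:R).
    by apply/funext => n; rewrite /t; ring.
  rewrite -[0 in X in _ --> X](mul0r (2 ^+ D * D%:R)); apply: cvgMl.
  rewrite -[0 in X in _ --> X](mulr0 0); apply: cvgM L0 _.
  (* The exponent of s n^(d-2) is delta - 1. *)
  by apply: eq_npow_cvg0 hsd; rewrite d2; lra.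
have v0 : v n @[n --> \oo] --> (0 : R).
  have -> : v = fun n => p n * p n / q n * (s n * (n ^ (d - 2))%:R) *
      (s n * (n ^ d)%:R) * (4 * 2 ^+ D * D%:R).
    by apply/funext => n; rewrite /v /t /L; ring.
  rewrite -[0 in X in _ --> X](mul0r (4 * 2 ^+ D * D%:R)); apply: cvgMl.
  have hsn := eq_npowM hs (eq_npow_natX d).
  (* The exponents 2 alpha - 1 - beta, delta - 1 and delta + 1 add up to a number that is negative
     exactly by [hbeta]. *)
  apply: eq_npow_cvg0 (eq_npowM (eq_npowM hr hsd) hsn).
  by rewrite d2; lra.
have ev : expR (v n) @[n --> \oo] --> (1 : R).
  rewrite -[1 in X in _ --> X](@expR0 R).
  by apply: continuous_cvg v0; exact: continuous_expR.
have TV0 : TV (planted_law n d (s n) (p n) (q n)) (null_law n (q n))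
    @[n --> \oo] --> (0 : R).
  (* The free parameter of the chi-square bound is e/2, so exp (v n) - 1 must fall below (e/2)^2 to
     make the second term less than e/2. *)
  apply/cvgrPdist_lt => e e0; have e2 : 0 < e / 2 by lra.
  have L1 : \forall n \near \oo, L n < 1 by exact: cvgr_lt L0 _ _.
  have t2 : \forall n \near \oo, t n < 2^-1 by apply: cvgr_lt t0 _ _; lra.
  have ev1 : \forall n \near \oo, expR (v n) < 1 + e / 2 * (e / 2).
    by apply: cvgr_lt ev _ _; rewrite ltrDl mulr_gt0.
  near=> n.
  rewrite sub0r normrN ger0_norm ?bigmax_ge_id//.
  have /andP[_ qp] := hqp n.
  apply: le_lt_trans (TV_planted_null e2 (hs01 n) _ _ _ _) _.
  - by near: n; exact: eq_npow_gt0 hq.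
  - by rewrite qp hp1.
  - by apply/ltW; near: n.
  - by apply/ltW; near: n.
  rewrite [ltRHS]splitr ltrD2l ltr_pdivrMr// ltrBlDl.
  by near: n.
split=> // phi [c c0 det].
have TVc : \forall n \near \oo,
    TV (planted_law n d (s n) (p n) (q n)) (null_law n (q n)) < c.
  exact: cvgr_lt TV0 _ c0.
(* A single [n] with error sum at most 1 - c and TV below [c] is contradictory. *)
have [n [dn Tn]] := filter_ex (filterI det TVc).
have := le_trans (testing_error_ge (s n) (p n) (q n) (phi n)) dn.
by rewrite lerD2l lerN2 leNgt Tn.
Unshelve. all: by end_near. Qed.
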